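(* Let $\overrightarrow{C_n}$ be an oriented cycle on $n$ vertices. Then $$F(\overrightarrow{C_n})=\begin{cases}0, & \text{if it is a directed cycle},\\ n-1, & \text{otherwise.}\end{cases}$$
   Context: A finite simple digraph $D=(V,A)$ has finite nonempty vertex set $V$ and arc set $A$ consisting of ordered pairs of distinct vertices (no loops, no parallel arcs). $N_D^+(v)=\{u:(v,u)\in A\}$. An oriented graph is a digraph in which $(u,v)\in A$ implies $(v,u)\notin A$. An oriented cycle $\overrightarrow{C_n}$ is an oriented graph whose underlying undirected graph is the cycle $C_n$, $n\ge 3$. It is a directed cycle if its vertices can be labeled $v_1,\dots,v_n$ so that its arcs are exactly $(v_1,v_2),\dots,(v_{n-1},v_n),(v_n,v_1)$. Zero forcing: for $S\subseteq V$ let $B^0(S)=S$ and $B^{i+1}(S)=B^i(S)\cup\{w:\{w\}=N_D^+(v)\setminus B^i(S)\text{ for some }v\in B^i(S)\}$. $S$ is a zero forcing set (ZFS) if $B^t(S)=V$ for some $t\ge 0$, and a failed zero forcing set (FZFS) otherwise. The failed zero forcing number $F(D)$ is the largest cardinality of an FZFS of $D$. *)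

(* Defs.v *)
From mathcomp Require Import all_boot boolp.
Set Implicit Arguments.
Unset Strict Implicit.
Unset Printing Implicit Defensive.

Record digraph := Digraph {
  vertex :> finType;
  arc : rel vertex;
  arc_irrefl : irreflexive arc;
  vertex_gt0 : 0 < #|vertex|
}.

Definition out_nbhd (D : digraph) (v : D) : {set D} := [set u | arc v u].

Definition oriented (D : digraph) : Prop :=
  forall u v : D, arc u v -> ~~ arc v u.

Definition underlying (D : digraph) : rel D :=
  fun u v => arc u v || arc v u.

(* [ordS] is the successor modulo n; this is the cycle C_n for n >= 3. *)
Definition cycle_rel (n : nat) : rel 'I_n :=
  fun i j => (j == ordS i) || (i == ordS j).

Definition oriented_cycle (n : nat) (D : digraph) : Prop :=
  [/\ 3 <= n,
      oriented D
    & exists2 f : 'I_n -> D, bijective f &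
        forall i j, underlying (f i) (f j) = cycle_rel i j].

Definition directed_cycle (n : nat) (D : digraph) : Prop :=
  exists2 f : 'I_n -> D, bijective f &
    forall i j, arc (f i) (f j) = (j == ordS i).

Definition force_step (D : digraph) (B : {set D}) : {set D} :=
  B :|: [set w | [exists v in B, [set w] == out_nbhd v :\: B]].

Definition forced (D : digraph) (S : {set D}) (i : nat) : {set D} :=
  iter i (@force_step D) S.

Definition zero_forcing_set (D : digraph) (S : {set D}) : Prop :=
  exists t : nat, forced S t = [set: D].

Definition failed_zero_forcing_set (D : digraph) (S : {set D}) : Prop :=
  ~ zero_forcing_set S.

(* The maximum ranges over a nonempty family: vertices exist, so set0 fails. *)
Definition failed_zero_forcing_number (D : digraph) : nat :=
  \max_(S : {set D} | `[< failed_zero_forcing_set S >]) #|S|.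

(* Main.v *)
Require Import Defs.
From mathcomp Require Import all_boot.
From mathcomp Require Import boolp zify.
(* Makes [arc] the arc relation again: [path] has an [arc] too. *)
Import Defs.

(** In a directed cycle the out-neighbourhood of a vertex is a singleton, so one
    vertex forces the whole cycle and only the empty set fails. If every
    vertex of an oriented cycle has an in-neighbour, then an arc traversed
    backwards is followed by another such arc, hence all arcs turn the same way
    and the cycle is directed. A non-directed oriented cycle thus has a source,
    and a source is never forced: its complement is a failed set. *)

Lemma ordS_iter_onto {n : nat} (i j : 'I_n) :
  exists2 k, k <= n.*2 & iter k (@ordS n) i = j.
Proof.
have val_iter k : val (iter k (@ordS n) i) = (i + k) %% n.
  elim: k => [|k IHk] /=; first by rewrite addn0 modn_small.
  by rewrite IHk addnS -[in LHS]addn1 modnDml addn1.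
have [lt_in lt_jn] := (ltn_ord i, ltn_ord j).
(* [n - i] steps wrap around to 0, and [j] more reach [j]. *)
exists (n - i + j); first by lia.
apply: val_inj; rewrite val_iter addnA subnKC ?(ltnW lt_in) //.
by rewrite modnDl modn_small.
Qed.

Lemma ordS_closed_full {n : nat} {P : 'I_n -> Prop} {i : 'I_n} :
  P i -> (forall k, P k -> P (ordS k)) -> forall j, P j.
Proof.
move=> Pi PS j; have [k _ <-] := ordS_iter_onto i j.
by elim: k => //= k; apply: PS.
Qed.

(** Reversal conjugates [ordS] to its inverse; this relabels a cycle whose arcs all run
    backwards. *)
Lemma ordS_rev_ordS {n : nat} (i : 'I_n) : ordS (rev_ord (ordS i)) = rev_ord i.
Proof.
apply: val_inj => /=; have lt_in := ltn_ord i.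
have [lt_Sin | le_nSi] := ltnP i.+1 n.
  by rewrite (modn_small lt_Sin) modn_small; lia.
(* Wrap-around case: [i] is the last index and [ordS i] is 0. *)
have -> : i.+1 = n by lia.
by rewrite modnn subn1 prednK ?modnn; lia.
Qed.

Section Forcing.

Context {D : digraph}.
Implicit Types (S B : {set D}) (v w : D).

Lemma forced_leq S {s t} : s <= t -> forced S s \subset forced S t.
Proof.
move=> /subnK <-; elim: (t - s) => [|k IHk]; first exact: subxx.
by apply: subset_trans IHk _; rewrite /forced addSn iterS subsetUl.
Qed.

Lemma force_step_out1 {B v w} :
  out_nbhd v = [set w] -> v \in B -> w \in force_step B.
Proof.
move=> Nv Bv; rewrite !inE; case: (boolP (w \in B)) => //= nBw.
apply/existsP; exists v; rewrite Bv Nv; apply/eqP/setP => x.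
by rewrite !inE; case: eqP => [->|]; rewrite ?nBw ?andbF.
Qed.

Lemma source_complement_failed {w} :
  (forall v, ~~ arc v w) -> failed_zero_forcing_set [set~ w].
Proof.
move=> w_source [t].
suff -> : forced [set~ w] t = [set~ w].
  by move/setP/(_ w); rewrite !inE eqxx.
elim: t => //= t IHt; rewrite -/(forced _ t) IHt; apply/setP => x.
rewrite !inE; case: (eqVneq x w) => //= ->.
apply/existsP => -[v /andP[_ /eqP/setP/(_ w)]].
by rewrite !inE !eqxx (negPf (w_source v)).
Qed.

Lemma failed_card_leq {S} : failed_zero_forcing_set S -> #|S| <= #|D|.-1.
Proof.
move=> failS; rewrite -ltnS prednK ?vertex_gt0 // -cardsT proper_card //.
by rewrite properT; apply/eqP => ST; apply: failS; exists 0.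
Qed.

End Forcing.

Lemma directed_cycle_zero_forcing {n : nat} {D : digraph} {S : {set D}} {x : D} :
  directed_cycle n D -> x \in S -> zero_forcing_set S.
Proof.
move=> [f [g fK gK] arcE] Sx; exists n.*2; apply/setP => y; rewrite inE.
have [k le_k gy] := ordS_iter_onto (g x) (g y).
(* Each [y] is reached at its own time [k]; monotonicity carries it to the common time [n.*2]. *)
apply: (subsetP (forced_leq S le_k)).
rewrite -(gK y) -gy {le_k gy}; elim: k => [|k IHk]; first by rewrite /= gK.
rewrite iterS /forced iterS; apply: force_step_out1 IHk.
apply/setP => z; rewrite !inE -[z]gK arcE.
by rewrite (can_eq fK).
Qed.

Lemma sourceless_cycle_directed {n : nat} {D : digraph} :
    oriented_cycle n D -> (forall w : D, exists v : D, arc v w) ->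
  directed_cycle n D.
Proof.
move=> [_ orD [f bij_f adjE]] has_in.
have fwd_or_bwd i : arc (f i) (f (ordS i)) \/ arc (f (ordS i)) (f i).
  by apply/orP; rewrite -/(underlying _ _) adjE /cycle_rel eqxx.
(* Stated for any labelling [h], as it serves both [f] and its reversal. *)
have all_same_way (h : 'I_n -> D) : bijective h ->
    (forall i j, underlying (h i) (h j) = cycle_rel i j) ->
    (forall i, arc (h i) (h (ordS i))) -> directed_cycle n D.
  move=> bij_h hadjE fwd; exists h => // i j.
  have [-> | ne_j] := eqVneq j (ordS i); first exact: fwd.
  apply/negbTE/negP => a_ij.
  have: underlying (h i) (h j) by rewrite /underlying a_ij.
  rewrite hadjE /cycle_rel (negPf ne_j) /= => /eqP i_eq.
  by move: (orD _ _ a_ij); rewrite i_eq fwd.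
case: (pselect (forall i, arc (f i) (f (ordS i)))) => [|/existsNP[i0 not_fwd]].
  exact: all_same_way.
have bwd : forall i, arc (f (ordS i)) (f i).
  apply: (ordS_closed_full (i := i0)) => [|i bwd_i].
    by case: (fwd_or_bwd i0) => // /not_fwd.
  (* An in-neighbour of [f (ordS i)] is one of its two cycle neighbours; [f i] is excluded by
     [bwd_i] and orientedness, so it is the next vertex. *)
  have [v arc_v] := has_in (f (ordS i)).
  have [g fK gK] := bij_f.
  have: underlying (f (g v)) (f (ordS i)) by rewrite /underlying gK arc_v.
  rewrite adjE /cycle_rel => /orP[/eqP/ordS_inj i_eq | /eqP <-].
    by move: (orD _ _ bwd_i); rewrite {1}i_eq gK arc_v.
  by rewrite gK.
apply: (all_same_way (f \o @rev_ord n)).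
- by apply: bij_comp bij_f _; exists (@rev_ord n); apply: rev_ordK.
- move=> i j; rewrite /= adjE /cycle_rel orbC.
  have rev_eq (k l : 'I_n) : (rev_ord l == ordS (rev_ord k)) = (k == ordS l).
    rewrite -[rev_ord l]ordS_rev_ordS (inj_eq (@ordS_inj n)).
    by rewrite (inj_eq rev_ord_inj) eq_sym.
  by rewrite !rev_eq.
- by move=> i /=; rewrite -[rev_ord i]ordS_rev_ordS.
Qed.

Theorem theorem4p8 (n : nat) (D : digraph) (hD : oriented_cycle n D) :
  (directed_cycle n D -> failed_zero_forcing_number D = 0) /\
  (~ directed_cycle n D -> failed_zero_forcing_number D = n - 1).
Proof.
split=> [dirD | not_dirD].
  apply/eqP; rewrite -leqn0; apply/bigmax_leqP => S /asboolP failS.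
  rewrite leqn0 cards_eq0; apply/set0Pn => -[x Sx].
  exact/failS/(directed_cycle_zero_forcing dirD Sx).
have cardD : #|D| = n.
  by have [_ _ [f /bij_eq_card <- _]] := hD; rewrite card_ord.
have [w w_source] : exists w : D, forall v : D, ~~ arc v w.
  apply: contrapT => no_source; apply: not_dirD.
  apply: sourceless_cycle_directed hD _ => w; apply: contrapT => no_in.
  by apply: no_source; exists w => v; apply/negP => a_vw; apply: no_in; exists v.
rewrite subn1 -cardD; apply/eqP; rewrite eqn_leq; apply/andP; split.
  by apply/bigmax_leqP => S /asboolP; apply: failed_card_leq.
(* The complement of the source [w] attains the upper bound. *)
rewrite -(cardsC1 w); apply: (leq_bigmax_cond (F := fun S : {set D} => #|S|)).
exact/asboolP/source_complement_failed.
Qed.
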